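(* For every integer $n>0$: (i) $$\sum_{m=\lfloor\frac{1-\sqrt{1+12n}}{6}\rfloor+1}^{\lceil\frac{1+\sqrt{1+12n}}{6}\rceil-1}\ \sum_{k=0}^{\lceil\frac{-1+\sqrt{1+8n}}{2}\rceil-1}(-1)^mK_{\leq}(n-T_k-2P_m)$$ $$\equiv\sum_{\substack{r,s,t\in\mathbb Z,\ l\geq1\\ n=P_r+P_s+2P_t+P_l}}(-1)^{r+s+t+l-1}l+\sum_{\substack{r,s,t\in\mathbb Z,\ l\geq1\\ n=P_r+P_s+2P_t+P_{-l}}}(-1)^{r+s+t+l-1}l\pmod4.$$ (ii) $$\sum_{m=\lfloor\frac{1-\sqrt{1+12n}}{6}\rfloor+1}^{\lceil\frac{1+\sqrt{1+12n}}{6}\rceil-1}\ \sum_{k=0}^{\lceil\frac{-1+\sqrt{1+8n}}{2}\rceil-1}(-1)^mK_{<}(n-T_k-2P_m)$$ $$\equiv\sum_{\substack{r,s,t\in\mathbb Z,\ j\geq1,\ l\geq0\\ n=P_r+P_s+2P_t+j+P_{-l}}}(-1)^{r+s+t+l}+\sum_{\substack{r,s,t\in\mathbb Z,\ j\geq1,\ l\geq1\\ n=P_r+P_s+2P_t+j+3T_l}}(-1)^{r+s+t+l}\pmod4.$$ (iii) $$\sum_{m=\lfloor\frac{1-\sqrt{1+12n}}{6}\rfloor+1}^{\lceil\frac{1+\sqrt{1+12n}}{6}\rceil-1}\ \sum_{k=0}^{\lceil\frac{-1+\sqrt{1+8n}}{2}\rceil-1}(-1)^mK_{>}(n-T_k-2P_m)$$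 $$\equiv\sum_{\substack{r,s,t\in\mathbb Z,\ l\geq1\\ n=P_r+P_s+2P_t+P_l}}(-1)^{r+s+t+l}(l-1)+\sum_{\substack{r,s,t\in\mathbb Z,\ l\geq1\\ n=P_r+P_s+2P_t+P_{-l}}}(-1)^{r+s+t+l}(l-1)\pmod4.$$ Here the right-hand sums run over all tuples of integers satisfying the displayed constraints, and $K_{\leq}(j)=K_{<}(j)=K_{>}(j)=0$ for every integer $j\le 0$.
   Context: For a partition $\pi$ of a positive integer $n$, the Kimberling index is $K(\pi)=(\text{largest part of }\pi)-(\text{least part of }\pi)-(\text{number of parts of }\pi)$. For $n\ge1$, $K_{\leq}(n)$, $K_{<}(n)$, $K_{>}(n)$ denote the numbers of partitions $\pi$ of $n$ with $K(\pi)\le 0$, $K(\pi)<0$, $K(\pi)>0$ respectively. For $m\in\mathbb{Z}$, $P_m=\frac{m(3m-1)}{2}$; for an integer $k\ge 0$, $T_k=\frac{k(k+1)}{2}$. *)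

(* Defs.v *)
From HB Require Import structures.
From mathcomp Require Import all_boot all_order all_algebra finmap.
From mathcomp Require Import mathcomp_extra boolp classical_sets functions.
From mathcomp Require Import cardinality fsbigop reals.

Set Implicit Arguments.
Unset Strict Implicit.
Unset Printing Implicit Defensive.

Import Order.TTheory GRing.Theory Num.Theory.

Local Open Scope classical_set_scope.
Local Open Scope ring_scope.

(* Partitions are weakly decreasing lists of positive parts, so the largest
   part is the head and the least part is the last element. *)
Definition is_partition (n : int) (s : seq nat) : bool :=
  [&& sorted geq s, 0%N \notin s & (sumn s)%:Z == n].

Definition kimberling (s : seq nat) : int :=
  (head 0%N s)%:Z - (last 0%N s)%:Z - (size s)%:Z.

(* The convention K(j) = 0 for j <= 0 is enforced here; in particular the empty
   partition of 0 is not counted.  The set of partitions of n is finite, so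
   fset_set is its enumeration and not the default value for infinite sets. *)
Definition count_kimberling (C : int -> bool) (n : int) : int :=
  if 0 < n then
    (#|` fset_set [set s : seq nat | is_partition n s && C (kimberling s)] |)%:Z
  else 0.

Definition K_le : int -> int := count_kimberling (fun k => k <= 0).
Definition K_lt : int -> int := count_kimberling (fun k => k < 0).
Definition K_gt : int -> int := count_kimberling (fun k => 0 < k).

(* Both divisions by 2 are exact. *)
Definition pent (m : int) : int := (m * (3 * m - 1) %/ 2)%Z.
Definition tri (k : int) : int := (k * (k + 1) %/ 2)%Z.

Definition m_min (R : realType) (n : int) : int :=
  Num.floor ((1 - Num.sqrt (1 + 12 * n%:~R)) / 6 : R) + 1.
Definition m_max (R : realType) (n : int) : int :=
  Num.ceil ((1 + Num.sqrt (1 + 12 * n%:~R)) / 6 : R) - 1.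
Definition k_max (R : realType) (n : int) : int :=
  Num.ceil ((- 1 + Num.sqrt (1 + 8 * n%:~R)) / 2 : R) - 1.

Definition double_sum (R : realType) (K : int -> int) (n : int) : int :=
  \sum_(m \in [set m : int | m_min R n <= m <= m_max R n])
    \sum_(k \in [set k : int | 0 <= k <= k_max R n])
      (-1 : int) ^ m * K (n - tri k - 2 * pent m).

(* Main.v *)
Require Import Defs.
From HB Require Import structures.
From mathcomp Require Import all_boot all_order all_algebra finmap.
From mathcomp Require Import mathcomp_extra boolp classical_sets functions.
From mathcomp Require Import cardinality fsbigop reals.
From mathcomp Require Import ring lra zify.

Import Order.TTheory GRing.Theory Num.Theory.

Local Open Scope classical_set_scope.
Local Open Scope ring_scope.

(** Subtracting the least part m from each of the N parts leaves a partition
    with at most N - 1 parts, each at most N - 1 + d when K < d, so the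
    partitions with K < d have generating function
      G_d = sum_{N >= 1} q^N / (1 - q^N) [2N - 2 + d; N - 1]_q.
    Expanding the Gaussian binomial by the q-binomial theorem, then using
    Euler's sum for 1/(x)_oo and the Rogers-Fine identity for
    sum_n (x)_n x^n, one gets
      (q)_oo G_d = sum_{L >= 1} (-1)^(L-1) q^(P_L) (1 + q^L)
                     (1 + q^(d-1) + ... + q^((L-1)(d-1))).
    The values d = 1, d = 0 and d large give K_<=, K_< and all partitions.
    Finally sum_k q^(T_k) = (q)_oo prod (1 + q^i)^2 is congruent to
    (q)_oo^3 mod 4; multiplying by it and by the pentagonal series in q^2, and
    expanding the two remaining factors (q)_oo by the pentagonal number
    theorem, gives the three congruences. *)

(** * q-series *)

(** In the applications a term with i + j >= T carries a vanishing power of q, so a sum over a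
    square can be regrouped along antidiagonals. *)
Lemma sum_triangle (V : nmodType) (T : nat) (F : nat -> nat -> V) :
  (forall i j, (T <= i + j)%N -> F i j = 0) ->
  \sum_(i < T) \sum_(j < T) F i j =
  \sum_(n < T) \sum_(i < n.+1) F i (n - i)%N.
Proof.
move=> F0.
transitivity (\sum_(0 <= n < T) \sum_(0 <= i < T | (i <= n)%N) F i (n - i)%N).
  rewrite [RHS](exchange_big_dep predT) //= big_mkord; apply: eq_bigr => i _.
  rewrite (big_cat_nat (n := i)) //=; last exact: ltnW.
  rewrite [X in X + _]big_nat_cond [X in X + _]big_pred0 ?add0r; last first.
    by move=> n; apply/negP => /andP[/andP[_ ?] ?]; lia.
  transitivity (\sum_(i <= n < T) F i (n - i)%N); last first.
    by rewrite big_nat [RHS]big_nat_cond; apply: eq_bigl => n; lia.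
  rewrite -{2}[val i]add0n big_addn -(big_mkord xpredT (F i)).
  rewrite (big_cat_nat (n := (T - i)%N)) ?leq_subr //=.
  rewrite [X in _ + X]big_nat_cond [X in _ + X]big1 ?addr0.
    by apply: eq_big_nat => j _; rewrite addnK.
  by move=> j /andP[/andP[hj _] _]; apply: F0; lia.
rewrite big_mkord; apply: eq_bigr => n _.
rewrite -(big_mkord xpredT (fun i => F i (n - i)%N)).
by rewrite (big_nat_widen 0 n.+1 T).
Qed.

(** The pentagonal number P_l for l >= 0, free of division; P_(-l) is [pentn l + l]. *)
Definition pentn (l : nat) : nat := (l + 3 * 'C(l, 2))%N.

Lemma bin2S (k : nat) : 'C(k.+1, 2) = ('C(k, 2) + k)%N.
Proof. by rewrite binS bin1. Qed.

Lemma bin2D (a b : nat) : 'C(a + b, 2) = ('C(a, 2) + 'C(b, 2) + a * b)%N.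
Proof.
elim: b => [|b IH]; first by rewrite addn0 bin0n; lia.
by rewrite addnS !bin2S IH; lia.
Qed.

(* Power series in q are truncated: q is nilpotent, q^T = 0, in a commutative
   ring, so that all sums and products are finite. *)
Section Truncated.

Context {A : comNzRingType} (q : A) (T : nat).
Hypothesis qT : q ^+ T = 0.

Lemma expq0 n : (T <= n)%N -> q ^+ n = 0.
Proof. by move=> h; rewrite -(subnK h) exprD qT mulr0. Qed.

Lemma expqX0 n m : (0 < n)%N -> (T <= m)%N -> (q ^+ n) ^+ m = 0.
Proof. by move=> n0 h; rewrite -exprM expq0 //; nia. Qed.

(** [poch x n] is (x)_n. A general ring has no division, so reciprocals are explicit elements:
    [geo x] stands for 1 / (1 - x) and [iqfac n] for 1 / (q)_n. *)
Definition poch (x : A) (n : nat) : A := \prod_(i < n) (1 - x * q ^+ i).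
Definition geo (x : A) : A := \sum_(i < T) x ^+ i.
Definition qfac (n : nat) : A := poch q n.
Definition iqfac (n : nat) : A := \prod_(i < n) geo (q ^+ i.+1).
(* (q)_oo, since the later factors are 1. *)
Definition phi : A := qfac T.

Lemma geoP (x : A) : x ^+ T = 0 -> (1 - x) * geo x = 1.
Proof. by move=> xT; rewrite -opprB mulNr -subrX1 xT sub0r opprK. Qed.

Lemma pochS x n : poch x n.+1 = poch x n * (1 - x * q ^+ n).
Proof. by rewrite /poch big_ord_recr. Qed.

Lemma poch0 x : poch x 0 = 1.
Proof. by rewrite /poch big_ord0. Qed.

Lemma pochSl x n : poch x n.+1 = (1 - x) * poch (x * q) n.
Proof.
rewrite /poch big_ord_recl expr0 mulr1; congr (_ * _).
by apply: eq_bigr => i _; rewrite /= /bump add1n exprS mulrA.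
Qed.

Lemma qfacS n : qfac n.+1 = qfac n * (1 - q ^+ n.+1).
Proof. by rewrite /qfac pochS exprS. Qed.

Lemma qfac0 : qfac 0 = 1. Proof. exact: poch0. Qed.

Lemma iqfacS n : iqfac n.+1 = iqfac n * geo (q ^+ n.+1).
Proof. by rewrite /iqfac big_ord_recr. Qed.

Lemma iqfac0 : iqfac 0 = 1.
Proof. by rewrite /iqfac big_ord0. Qed.

Lemma geoq n : (1 - q ^+ n.+1) * geo (q ^+ n.+1) = 1.
Proof. by rewrite geoP // expqX0. Qed.

Lemma iqfacSK n : (1 - q ^+ n.+1) * iqfac n.+1 = iqfac n.
Proof. by rewrite iqfacS mulrCA geoq mulr1. Qed.

Lemma qfacK n : qfac n * iqfac n = 1.
Proof.
elim: n => [|n IH]; first by rewrite qfac0 iqfac0 mulr1.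
by rewrite qfacS -mulrA iqfacSK.
Qed.

Lemma qfacD m n : qfac (m + n) = qfac m * poch (q ^+ m.+1) n.
Proof.
elim: n => [|n IH]; first by rewrite addn0 poch0 mulr1.
by rewrite addnS qfacS IH pochS -exprD addSn mulrA.
Qed.

Lemma qfac_ge n : (T <= n)%N -> qfac n = phi.
Proof.
move=> h; rewrite -(subnKC h) qfacD /poch big1 ?mulr1 // => i _.
by rewrite -exprD expq0 ?subr0 //; lia.
Qed.

Lemma iqfac_ge n : (T <= n)%N -> iqfac n = iqfac T.
Proof.
move=> h; rewrite -[LHS]mulr1 -(qfacK T) -/phi -(qfac_ge _ h) mulrA.
by rewrite [iqfac n * _]mulrC qfacK mul1r.
Qed.

Lemma subq_lreg n (x y : A) :
  (1 - q ^+ n.+1) * x = (1 - q ^+ n.+1) * y -> x = y.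
Proof.
move=> /(congr1 ( *%R (geo (q ^+ n.+1)))).
by rewrite !mulrA ![geo _ * _]mulrC geoq !mul1r.
Qed.

(** * Gaussian binomial coefficients *)

Definition gauss (a b : nat) : A := qfac (a + b) * iqfac a * iqfac b.

Lemma gaussC a b : gauss a b = gauss b a.
Proof. by rewrite /gauss addnC mulrAC. Qed.

Lemma gauss0n b : gauss 0 b = 1.
Proof. by rewrite /gauss iqfac0 mulr1 qfacK. Qed.

Lemma gaussn0 a : gauss a 0 = 1.
Proof. by rewrite gaussC gauss0n. Qed.

Lemma gaussS a b :
  gauss a.+1 b.+1 = gauss a b.+1 + q ^+ a.+1 * gauss a.+1 b.
Proof.
rewrite /gauss addSn addnS qfacS addSn -(iqfacSK a) -[in RHS](iqfacSK b).
rewrite -addnS -addSn exprD; ring.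
Qed.

Lemma gaussS' a b :
  gauss a.+1 b.+1 = q ^+ b.+1 * gauss a b.+1 + gauss a.+1 b.
Proof. by rewrite gaussC gaussS ![gauss b.+1 _]gaussC ![gauss b _]gaussC addrC. Qed.

Lemma gauss_poch a b : gauss a b = poch (q ^+ b.+1) a * iqfac a.
Proof.
have h := qfacK b; rewrite /gauss addnC qfacD.
by rewrite -[RHS]mulr1 -h; ring.
Qed.

(** The Pascal recursion makes sense for every k, with value 0 for k > m, whereas [gauss] is indexed
    by the two sides of the box and is visibly symmetric. *)
Fixpoint gbin (m k : nat) {struct m} : A :=
  match m, k with
  | _, 0 => 1
  | 0, _.+1 => 0
  | m'.+1, k'.+1 => gbin m' k' + q ^+ k * gbin m' k
  end.

Lemma gbin0 m : gbin m 0 = 1. Proof. by case: m. Qed.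

Lemma gbinS m k : gbin m.+1 k.+1 = gbin m k + q ^+ k.+1 * gbin m k.+1.
Proof. by []. Qed.

Lemma gbin_small m k : (m < k)%N -> gbin m k = 0.
Proof.
elim: m k => [|m IH] [|k] //= h.
by rewrite !IH ?mulr0 ?addr0 // ltnW.
Qed.

Arguments gbin m k : simpl never.

Lemma gbinE a b : gbin (a + b) a = gauss a b.
Proof.
elim: a b => [|a IHa] b; first by rewrite gbin0 gauss0n.
elim: b => [|b IHb].
  by rewrite addn0 gbinS -{1}[a]addn0 IHa !gaussn0 gbin_small ?mulr0 ?addr0.
by rewrite addSn gbinS IHa addnS -addSn IHb gaussS.
Qed.

Lemma gbinS' m k : (k <= m)%N ->
  gbin m.+1 k.+1 = q ^+ (m - k) * gbin m k + gbin m k.+1.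
Proof.
move=> h; rewrite -(subnKC h) addKn; case: (m - k)%N => [|b].
  by rewrite addn0 gbinS (gbin_small k k.+1) // mulr0 mul1r.
by rewrite gbinE -addSn gbinE gaussS' addnS -addSn gbinE.
Qed.

(** Induction on n through (x)_(n+1) = (1 - x) (xq)_n, with the hypothesis taken at xq. *)
Lemma q_binomial (x : A) n :
  poch x n = \sum_(k < n.+1) (-1) ^+ k * q ^+ 'C(k, 2) * x ^+ k * gbin n k.
Proof.
elim: n x => [|n IH] x; first by rewrite poch0 big_ord1 /= !expr0 !mulr1.
pose f k := (-1) ^+ k * q ^+ 'C(k, 2) * (x * q) ^+ k * gbin n k.
(* The term at k = 0 is 1 and the one at k = n + 1 is 0, so the index can be shifted to line up with
   the Pascal rule. *)
have fS : 1 + \sum_(k < n.+1) f k.+1 = \sum_(k < n.+1) f k.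
  transitivity (\sum_(k < n.+2) f k).
    by rewrite [RHS]big_ord_recl {2}/f /= bin0n !expr0 gbin0 !mulr1.
  by rewrite big_ord_recr /= {2}/f gbin_small // mulr0 addr0.
rewrite pochSl IH -/(\sum_(k < n.+1) f k) mulrBl mul1r -{1}fS [RHS]big_ord_recl.
rewrite /= !expr0 !mulr1 -addrA; congr (_ + _).
rewrite mulr_sumr -sumrB; apply: eq_bigr => i _; rewrite /f /bump add1n.
by rewrite gbinS bin2S !exprMn exprD !exprS; ring.
Qed.

(** * Euler's sum and the Rogers-Fine identity *)

Definition eulersum (x : A) : A := \sum_(M < T) x ^+ M * iqfac M.

(** Termwise, (1 - q^M) / (q)_M = 1 / (q)_(M-1), so the series at x minus the series at xq is x
    times the series at x. *)
Lemma eulersum_shift (x : A) : x ^+ T = 0 ->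
  (1 - x) * eulersum x = eulersum (x * q).
Proof.
move=> xT; apply/eqP; rewrite mulrBl mul1r subr_eq addrC -subr_eq -sumrB.
rewrite /eulersum; apply/eqP.
case: T xT => [|t] xT; first by rewrite !big_ord0 mulr0.
rewrite big_ord_recl /= !expr0 subrr add0r mulr_sumr [in RHS]big_ord_recr /=.
rewrite mulrA -exprS xT mul0r addr0; apply: eq_bigr => i _.
rewrite exprMn -mulrBl -[in RHS](iqfacSK i) /bump add1n exprS; ring.
Qed.

(** Descending induction on j: for j >= T the argument is 0 and both sides are (q)_oo; each step
    down cancels the unit 1 - q^(j+1). *)
Lemma eulersumE j : phi * eulersum (q ^+ j.+1) = qfac j.
Proof.
elim: {j}(T - j)%N {-2}j (leqnn (T - j)) => [|n IH] j hj.
  have h : (T <= j)%N by rewrite -subn_eq0 -leqn0.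
  rewrite qfac_ge // expq0 ?leqW // /eulersum.
  (* T = 0 would give 1 = 0. *)
  case: (T) (qT) => [|t]; first by move/eqP; rewrite expr0 oner_eq0.
  move=> _; rewrite big_ord_recl /= big1 ?iqfac0 ?expr0 ?addr0 ?mulr1 //.
  by move=> i _; rewrite expr0n mul0r.
apply: (@subq_lreg j); rewrite mulrCA eulersum_shift ?expqX0 // -exprSr IH; last by lia.
by rewrite qfacS mulrC.
Qed.

(* By the functional equation x -> x q, which [fine_series] shares and which
   ends at 0 after T steps, the two sides of the Rogers-Fine identity agree. *)
Definition fine_sum (x : A) : A := \sum_(n < T) x ^+ n * poch x n.

(** Splitting off the first factor of (x)_(n+1) expresses the sum at x through U, the sum of x^n
    (xq)_n; splitting off the last factor of (xq)_(n+1) does so for the sum at xq. Eliminating U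
    gives the relation. *)
Lemma fine_sum_shift (x : A) : x ^+ T = 0 ->
  fine_sum x = 1 + x - x ^+ 3 * q * fine_sum (x * q).
Proof.
move=> xT; pose U := \sum_(n < T) x ^+ n * poch (x * q) n.
have fineU : fine_sum x = 1 + x * (1 - x) * U.
  transitivity (\sum_(n < T.+1) x ^+ n * poch x n).
    by rewrite [RHS]big_ord_recr /= xT mul0r addr0.
  rewrite big_ord_recl /= expr0 poch0 mulr1; congr (_ + _).
  rewrite mulr_sumr; apply: eq_bigr => i _.
  by rewrite /bump add1n pochSl exprS; ring.
have US : x ^+ 2 * q * fine_sum (x * q) = x * U - (U - 1).
  have -> : U - 1 = \sum_(n < T) x ^+ n.+1 * poch (x * q) n.+1.
    apply/eqP; rewrite subr_eq addrC; apply/eqP.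
    transitivity (\sum_(n < T.+1) x ^+ n * poch (x * q) n).
      by rewrite [RHS]big_ord_recr /= xT mul0r addr0.
    by rewrite big_ord_recl /= expr0 poch0 mulr1.
  rewrite /U !mulr_sumr -sumrB; apply: eq_bigr => i _.
  by rewrite pochS exprMn !exprS; ring.
have -> : x ^+ 3 * q * fine_sum (x * q) = x * (x ^+ 2 * q * fine_sum (x * q)).
  by ring.
by rewrite US fineU; ring.
Qed.

Definition fine_series (x : A) : A :=
  \sum_(n < T) (-1) ^+ n * x ^+ (3 * n) * q ^+ pentn n * (1 + x * q ^+ n).

Lemma fine_series_shift (x : A) : x ^+ T = 0 ->
  fine_series x = 1 + x - x ^+ 3 * q * fine_series (x * q).
Proof.
move=> xT.
pose f n := (-1) ^+ n * x ^+ (3 * n) * q ^+ pentn n * (1 + x * q ^+ n).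
transitivity (\sum_(n < T.+1) f n).
  rewrite [RHS]big_ord_recr /= /f mulnC exprM.
  by rewrite [(x ^+ T) ^+ 3]exprS xT !(mul0r, mulr0) addr0.
rewrite big_ord_recl {1}/f /= !expr0 !mul1r mulr1; congr (_ + _).
rewrite mulr_sumr -sumrN; apply: eq_bigr => i _; rewrite /f /bump add1n.
have -> : pentn i.+1 = (pentn i + 3 * i + 1)%N by rewrite /pentn bin2S; lia.
rewrite mulnS !exprD !exprMn !exprS expr0; ring.
Qed.

Lemma fine_sumE j : fine_sum (q ^+ j.+1) = fine_series (q ^+ j.+1).
Proof.
have xT i : (q ^+ i.+1) ^+ T = 0 by exact: expqX0.
elim: {j}(T - j)%N {-2}j (leqnn (T - j)) => [|n IH] j hj.
  have x0 : (q ^+ j.+1) ^+ 3 = 0 by rewrite -exprM expq0 //; lia.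
  by rewrite (fine_sum_shift _ (xT j)) (fine_series_shift _ (xT j)) x0 !mul0r.
rewrite (fine_sum_shift _ (xT j)) (fine_series_shift _ (xT j)) -exprSr IH //.
by lia.
Qed.

(* The term N accounts for the partitions with N + 1 parts, see
   [kpartitions_gf]. *)
Definition kgf (d : nat) : A :=
  \sum_(N < T) q ^+ N.+1 * iqfac N.+1 * poch (q ^+ (N.+1 + d)) N.

Lemma gbin_iqfac n k : (k <= n)%N ->
  iqfac n * gbin n k = iqfac k * iqfac (n - k).
Proof.
move=> h; rewrite -{1 2}(subnKC h) gbinE /gauss.
by rewrite -!mulrA mulrA [iqfac _ * qfac _]mulrC qfacK mul1r.
Qed.

(** Expanding 1 / (1 - q^(M+k+1)) geometrically and exchanging sums yields Euler sums at q^(k+n+1),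
    worth (q)_(k+n) / (q)_oo; dividing by (q)_k leaves (q^(k+1))_n. *)
Lemma phi_eulersum k : 
  phi * (iqfac k *
    \sum_(M < T) q ^+ (M * k.+1) * (iqfac M * geo (q ^+ (M + k.+1)))) =
  fine_sum (q ^+ k.+1).
Proof.
have -> : \sum_(M < T) q ^+ (M * k.+1) * (iqfac M * geo (q ^+ (M + k.+1))) =
          \sum_(n < T) (q ^+ k.+1) ^+ n * eulersum (q ^+ (k + n).+1).
  transitivity (\sum_(M < T) \sum_(n < T)
      (q ^+ k.+1) ^+ n * ((q ^+ (k + n).+1) ^+ M * iqfac M)).
    apply: eq_bigr => M _; rewrite /geo !mulr_sumr; apply: eq_bigr => n _.
    rewrite [iqfac M * _]mulrC !mulrA; congr (_ * _).
    by rewrite -!exprM -!exprD; congr (q ^+ _); lia.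
  by rewrite exchange_big /=; apply: eq_bigr => n _; rewrite mulr_sumr.
rewrite !mulr_sumr; apply: eq_bigr => n _.
rewrite mulrCA [phi * _]mulrCA eulersumE mulrCA; congr (_ * _).
by rewrite qfacD mulrA [iqfac k * _]mulrC qfacK mul1r.
Qed.

(** The q-binomial theorem expands each Pochhammer factor; with N = k + M the sum over M is that of
    [phi_eulersum]. *)
Lemma phi_kgf_fine d : phi * kgf d =
  \sum_(k < T) (-1) ^+ k * q ^+ ('C(k, 2) + k * d + k.+1 * k.+1) *
    fine_sum (q ^+ k.+1).
Proof.
pose F k M := (-1) ^+ k * q ^+ ('C(k, 2) + k * d + k.+1 * k.+1) *
  (iqfac k * (q ^+ (M * k.+1) * (iqfac M * geo (q ^+ (M + k.+1))))).
have -> : kgf d = \sum_(k < T) \sum_(M < T) F k M.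
  rewrite sum_triangle; last first.
    move=> k M h; rewrite /F.
    have e : q ^+ ('C(k, 2) + k * d + k.+1 * k.+1) * q ^+ (M * k.+1) = 0.
      by rewrite -exprD expq0 //; nia.
    transitivity ((-1) ^+ k * iqfac k * iqfac M * geo (q ^+ (M + k.+1)) *
      (q ^+ ('C(k, 2) + k * d + k.+1 * k.+1) * q ^+ (M * k.+1))); first by ring.
    by rewrite e mulr0.
  apply: eq_bigr => N _; rewrite q_binomial mulr_sumr; apply: eq_bigr => k _.
  have hk : (k <= N)%N by rewrite -ltnS.
  have e : q ^+ ('C(k, 2) + k * d + k.+1 * k.+1) * q ^+ ((N - k) * k.+1) =
      q ^+ N.+1 * q ^+ 'C(k, 2) * (q ^+ (N.+1 + d)) ^+ k.
    by rewrite -exprM -!exprD; congr (q ^+ _); nia.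
  rewrite /F (_ : N - k + k.+1 = N.+1)%N; last by lia.
  transitivity ((-1) ^+ k *
    (q ^+ N.+1 * q ^+ 'C(k, 2) * (q ^+ (N.+1 + d)) ^+ k) *
    (iqfac N * gbin N k) * geo (q ^+ N.+1)); first by rewrite iqfacS; ring.
  by rewrite gbin_iqfac // -e; ring.
rewrite mulr_sumr; apply: eq_bigr => k _.
rewrite -(phi_eulersum k) -mulr_sumr -mulr_sumr; ring.
Qed.

(* The subtraction is not truncated, as k <= L <= pentn L.+1. *)
Lemma phi_kgf d : phi * kgf d =
  \sum_(L < T) (-1) ^+ L * (1 + q ^+ L.+1) *
    \sum_(k < L.+1) q ^+ (pentn L.+1 + k * d - k).
Proof.
pose F k n := (-1) ^+ (k + n) * (1 + q ^+ (k + n).+1) *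
  q ^+ (pentn (k + n).+1 + k * d - k).
transitivity (\sum_(k < T) \sum_(n < T) F k n).
  rewrite phi_kgf_fine; apply: eq_bigr => k _.
  rewrite fine_sumE /fine_series mulr_sumr; apply: eq_bigr => n _.
  rewrite /F -addSn.
  (* The exponents of the q-binomial and Rogers-Fine expansions merge into P_(k+n+1) + k (d - 1), so
     k + n becomes the new index L. *)
  have -> : (pentn (k.+1 + n) + k * d - k = 'C(k, 2) + k * d + k.+1 * k.+1 +
             k.+1 * (3 * n) + pentn n)%N.
    rewrite /pentn bin2D bin2S.
    have : (2 * 'C(k, 2) + k = k * k)%N.
      by elim: (val k) => // m; rewrite bin2S; lia.
    by nia.
  by rewrite -!exprM !exprD; ring.
rewrite sum_triangle => [|k n h]; last first.
  rewrite /F (expq0 (pentn _ + _ - _)) ?mulr0 // /pentn bin2S; lia.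
apply: eq_bigr => L _; rewrite mulr_sumr; apply: eq_bigr => k _.
by rewrite /F subnKC // -ltnS.
Qed.

(** Since (q)_n - (q)_(n+1) = q^(n+1) (q)_n, the left side telescopes to q times the Rogers-Fine sum
    at x = q. *)
Lemma pentagonal : 1 - phi =
  \sum_(L < T) (-1) ^+ L * (1 + q ^+ L.+1) * q ^+ pentn L.+1.
Proof.
transitivity (q * fine_sum q).
  rewrite /fine_sum mulr_sumr.
  transitivity (\sum_(n < T) (qfac n - qfac n.+1)).
    apply: oppr_inj; rewrite opprB -sumrN -qfac0.
    rewrite -(telescope_sumr qfac (leq0n T)) big_mkord.
    by apply: eq_bigr => n _; rewrite opprB.
  by apply: eq_bigr => n _; rewrite qfacS exprS /qfac; ring.
rewrite -[q in fine_sum q]expr1 fine_sumE /fine_series mulr_sumr.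
apply: eq_bigr => n _; rewrite expr1 -!exprS.
have -> : pentn n.+1 = (1 + 3 * n + pentn n)%N by rewrite /pentn bin2S; lia.
by rewrite !exprD expr1; ring.
Qed.

(** * The theta series of the triangular numbers *)

(** One step of each Pascal rule; this leads from row 2n + 1 to row 2n + 3 in [triangular_prod]. *)
Lemma gbinSS m k : (k <= m)%N ->
  gbin m.+2 k.+2 = q ^+ k.+2 * gbin m k.+2 + (1 + q ^+ m.+1) * gbin m k.+1
    + q ^+ (m - k) * gbin m k.
Proof.
move=> h; rewrite gbinS' // subSS !gbinS.
have -> : q ^+ m.+1 = q ^+ (m - k) * q ^+ k.+1.
  by rewrite -exprD; congr (q ^+ _); lia.
by ring.
Qed.

Lemma gbin_sym a b : gbin (a + b) a = gbin (a + b) b.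
Proof. by rewrite gbinE gaussC -gbinE addnC. Qed.

(* Finite form of the Jacobi triple product at z = 1, halved: the terms j and
   - j - 1 of the bilateral sum are equal. *)
Lemma triangular_prod n : \prod_(i < n) (1 + q ^+ i.+1) ^+ 2 =
  \sum_(j < n.+1) q ^+ 'C(j.+1, 2) * gbin n.*2.+1 (n.+1 + j).
Proof.
elim: n => [|n IH].
  rewrite big_ord0 big_ord1 double0 addn0 gbinS gbin0 gbin_small //.
  by rewrite mulr0 addr0 mulr1.
pose b j := gbin n.*2.+1 (n.+1 + j); pose f j := q ^+ 'C(j.+1, 2) * b j.
have b0 j : (n < j)%N -> b j = 0 by move=> h; rewrite /b gbin_small //; lia.
have f0 j : (n < j)%N -> f j = 0 by move=> h; rewrite /f b0 ?mulr0.
have bS j : (j <= n)%N -> gbin n.+1.*2.+1 (n.+2 + j.+1) =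
    q ^+ (n + 3 + j) * b j.+2 + (1 + q ^+ n.*2.+2) * b j.+1 + q ^+ (n - j) * b j.
  move=> h; rewrite doubleS addnS addSn gbinSS /b; last by lia.
  have -> : (n.*2.+1 - (n.+1 + j) = n - j)%N by lia.
  have -> : (n + 3 + j = (n.+1 + j).+2)%N by lia.
  by rewrite !addnS.
(* At j = 0 the lower neighbour lies in the left half of the row and is reflected back to [b 0]. *)
have bS0 : gbin n.+1.*2.+1 (n.+2 + 0) =
    q ^+ n.+2 * b 1%N + (1 + q ^+ n.*2.+2) * b 0%N + q ^+ n.+1 * b 0%N.
  rewrite addn0 doubleS gbinSS /b; last by lia.
  have -> : (n.*2.+1 - n = n.+1)%N by lia.
  rewrite addn0 addn1; congr (_ + _ * _).
  have -> : n.*2.+1 = (n.+1 + n)%N by lia.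
  by rewrite gbin_sym.
rewrite big_ord_recr /= IH -/(\sum_(j < n.+1) f j).
rewrite [RHS]big_ord_recl /= bS0 mul1r.
(* The factor (1 + q^(n+1))^2 is split as (1 + q^(2n+2)) + q^(n+1) + q^(n+1), and the three copies
   of the sum are shifted by 1, 2 and 0 to match the terms of [bS]. *)
transitivity ((1 + q ^+ n.*2.+2) * (f 0%N + \sum_(j < n.+1) f j.+1) +
  q ^+ n.+1 * (f 0%N + f 1%N + \sum_(j < n.+1) f j.+2) +
  q ^+ n.+1 * \sum_(j < n.+1) f j).
  have -> : f 0%N + \sum_(j < n.+1) f j.+1 = \sum_(j < n.+1) f j.
    transitivity (\sum_(j < n.+2) f j); first by rewrite [RHS]big_ord_recl.
    by rewrite big_ord_recr /= [X in _ + X]f0 // addr0.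
  have -> : f 0%N + f 1%N + \sum_(j < n.+1) f j.+2 = \sum_(j < n.+1) f j.
    transitivity (\sum_(j < n.+3) f j).
      by rewrite [RHS]big_ord_recl [X in _ = _ + X]big_ord_recl addrA.
    by rewrite 2!big_ord_recr /= [X in _ + X]f0 ?[X in _ + X + _]f0 // !addr0.
  have -> : q ^+ n.*2.+2 = (q ^+ n.+1) ^+ 2.
    by rewrite -exprM; congr (q ^+ _); lia.
  by ring.
have -> : \sum_(i < n.+1) q ^+ 'C((bump 0 i).+1, 2) *
      gbin n.+1.*2.+1 (n.+2 + bump 0 i) =
    (1 + q ^+ n.*2.+2) * \sum_(j < n.+1) f j.+1 +
    q ^+ n.+1 * \sum_(j < n.+1) f j.+2 + q ^+ n.+1 * \sum_(j < n.+1) f j; last first.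
  have -> : f 0%N = b 0%N by rewrite /f mul1r.
  have -> : f 1%N = q * b 1%N by rewrite /f expr1.
  by rewrite [q ^+ n.+2]exprS; ring.
rewrite !mulr_sumr -!big_split; apply: eq_bigr => j _.
have h1 : q ^+ 'C(j.+2, 2) * q ^+ (n - j) = q ^+ n.+1 * q ^+ 'C(j.+1, 2).
  by rewrite -!exprD bin2S; congr (q ^+ _); have := ltn_ord j; lia.
have h2 : q ^+ 'C(j.+2, 2) * q ^+ (n + 3 + j) = q ^+ n.+1 * q ^+ 'C(j.+3, 2).
  by rewrite -!exprD [in RHS]bin2S; congr (q ^+ _); lia.
rewrite /bump add1n bS -1?ltnS //.
transitivity (q ^+ 'C(j.+2, 2) * q ^+ (n + 3 + j) * b j.+2 +
  (1 + q ^+ n.*2.+2) * (q ^+ 'C(j.+2, 2) * b j.+1) +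
  q ^+ 'C(j.+2, 2) * q ^+ (n - j) * b j); first by ring.
by rewrite h1 h2 /f /=; ring.
Qed.

Definition psi : A := \sum_(j < T) q ^+ 'C(j.+1, 2).

(** With 2T factors, both sides of the box are at least T whenever j < T, so the Gaussian binomial
    is 1 / (q)_oo; for j >= T the power of q vanishes. *)
Lemma psi_prod : psi = phi * \prod_(i < T.*2) (1 + q ^+ i.+1) ^+ 2.
Proof.
have t0 j : (T <= j)%N -> q ^+ 'C(j.+1, 2) = 0.
  by move=> h; rewrite expq0 // bin2S; lia.
rewrite triangular_prod mulr_sumr.
transitivity (\sum_(j < T.*2.+1) q ^+ 'C(j.+1, 2)).
  rewrite (_ : T.*2.+1 = T + T.+1)%N; last by lia.
  rewrite big_split_ord /= [X in _ = _ + X]big1 ?addr0 // => j _.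
  by rewrite t0 ?leq_addr.
apply: eq_bigr => j _; have [h|h] := leqP T j; first by rewrite t0 // mul0r mulr0.
rewrite (_ : (T.*2).*2.+1 = (T.*2.+1 + j) + (T.*2 - j))%N; last by lia.
rewrite gbinE /gauss qfac_ge ?iqfac_ge //; try lia.
have h1 : phi * iqfac T = 1 by exact: qfacK.
by rewrite -[LHS]mulr1 -[in LHS]h1 -[LHS]mulr1 -[in LHS]h1; ring.
Qed.

(** Modulo 4, (1 + x)^2 = (1 - x)^2 + 4x becomes (1 - x)^2. *)
Lemma psi_mod4 : 4%:R = 0 :> A -> psi = phi ^+ 3.
Proof.
move=> A4; rewrite psi_prod (_ : \prod_(i < T.*2) _ = qfac T.*2 ^+ 2).
  by rewrite qfac_ge ?exprS //; lia.
rewrite /qfac /poch -prodrXl; apply: eq_bigr => i _; rewrite -exprS.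
transitivity ((1 - q ^+ i.+1) ^+ 2 + 4%:R * q ^+ i.+1); first by ring.
by rewrite A4 mul0r addr0.
Qed.

(** * The series for d = 1, d large and d = 0 *)

Lemma phi_kgf1 : phi * kgf 1 =
  \sum_(L < T) (-1) ^+ L * L.+1%:R * (q ^+ pentn L.+1 + q ^+ (pentn L.+1 + L.+1)).
Proof.
rewrite phi_kgf; apply: eq_bigr => L _.
rewrite (eq_bigr (fun=> q ^+ pentn L.+1)) => [|k _]; last by rewrite muln1 addnK.
by rewrite sumr_const card_ord exprD -mulr_natl; ring.
Qed.

(** With d beyond the truncation order, only k = 0 survives in the inner sum. *)
Lemma phi_kgf_all : phi * kgf T.+1 =
  \sum_(L < T) (-1) ^+ L * (q ^+ pentn L.+1 + q ^+ (pentn L.+1 + L.+1)).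
Proof.
rewrite phi_kgf; apply: eq_bigr => L _.
rewrite big_ord_recl big1 => [|k _].
  by rewrite mul0n addn0 subn0 exprD; ring.
by rewrite expq0 //= /bump; nia.
Qed.

(** For L >= 1 the inner sum is q^(3 T_(L-1)) q (1 - q^L) / (1 - q); multiplied by 1 + q^L it
    becomes q / (1 - q) times q^(3 T_(L-1)) - q^(P_(-L)). *)
Lemma phi_kgf0 : phi * kgf 0 = (\sum_(j < T) q ^+ j.+1) *
  (\sum_(l < T.+1) (-1) ^+ l * q ^+ (pentn l + l) +
   \sum_(l < T) (-1) ^+ l.+1 * q ^+ (3 * 'C(l.+2, 2))).
Proof.
have geo1 : \sum_(j < T) q ^+ j.+1 = q * geo q.
  by rewrite mulr_sumr; apply: eq_bigr => j _; rewrite exprS.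
have geoX n : geo q * (1 - q ^+ n) = \sum_(i < n) q ^+ i.
  have : (1 - q) * geo q = 1 by exact: geoP.
  have : 1 - q ^+ n = (1 - q) * \sum_(i < n) q ^+ i.
    by rewrite -opprB subrX1 -mulNr opprB.
  by move=> -> h; rewrite mulrA [geo q * _]mulrC h mul1r.
(* The term l = 0 is added and subtracted; the -1 will cancel the constant term of the other
   series. *)
have -> : \sum_(l < T) (-1) ^+ l.+1 * q ^+ (3 * 'C(l.+2, 2)) =
    \sum_(l < T) (-1) ^+ l * q ^+ (3 * 'C(l.+1, 2)) - 1.
  pose f l := (-1) ^+ l * q ^+ (3 * 'C(l.+1, 2)).
  transitivity (\sum_(l < T.+1) f l - 1).
    by rewrite big_ord_recl /f /= !mul1r addrC addKr.
  by rewrite big_ord_recr /= /f expq0 ?mulr0 ?addr0 // bin2S; lia.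
have -> : \sum_(l < T.+1) (-1) ^+ l * q ^+ (pentn l + l) =
    1 - \sum_(l < T) (-1) ^+ l * q ^+ (pentn l.+1 + l.+1).
  rewrite big_ord_recl /= mul1r -sumrN; congr (_ + _); apply: eq_bigr => l _.
  by rewrite /bump add1n exprS; ring.
rewrite phi_kgf [X in _ * X]addrC addrA subrK -sumrB mulr_sumr.
apply: eq_bigr => L _.
rewrite geo1.
have -> : \sum_(k < L.+1) q ^+ (pentn L.+1 + k * 0 - k) =
    q ^+ (3 * 'C(L.+1, 2)) * q * \sum_(k < L.+1) q ^+ k.
  rewrite -exprSr mulr_sumr [RHS](reindex_inj rev_ord_inj) /=.
  apply: eq_bigr => k _; rewrite -exprD; congr (q ^+ _).
  by rewrite /pentn; have := ltn_ord k; lia.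
have -> : (pentn L.+1 + L.+1 = 3 * 'C(L.+1, 2) + L.+1 + L.+1)%N.
  by rewrite /pentn; lia.
by rewrite -geoX !exprD; ring.
Qed.

End Truncated.

(** * Partitions by Kimberling index *)

Lemma allpairs_dep_inj_uniq (S R : eqType) (T : eqType) (f : S -> T -> R)
    (s : seq S) (t : S -> seq T) :
  uniq s -> (forall x, x \in s -> uniq (t x)) ->
  (forall x x' y y', f x y = f x' y' -> x = x' /\ y = y') ->
  uniq [seq f x y | x <- s, y <- t x].
Proof.
move=> us ut inj; apply: allpairs_uniq_dep => //.
by move=> [x y] [x' y'] _ _ /= /inj[-> ->].
Qed.

(** Partitions inside an a by b box, padded with zeros to length exactly a. *)
Fixpoint box_list (a b : nat) : seq (seq nat) :=
  if a is a'.+1 then [seq x :: s | x <- iota 0 b.+1, s <- box_list a' x]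
  else [:: [::]].

Lemma box_listS a b : box_list a.+1 b =
  [seq x :: s | x <- iota 0 b.+1, s <- box_list a x].
Proof. by []. Qed.

Lemma mem_box_list a b s :
  (s \in box_list a b) = (size s == a) && path geq b s.
Proof.
elim: a b s => [|a IH] b s; first by rewrite inE; case: s.
rewrite box_listS; apply/allpairsPdep/idP => [[x [t [hx ht ->]]]|].
  move: ht; rewrite IH => /andP[/eqP <- ht] /=; rewrite eqxx ht andbT /=.
  by move: hx; rewrite mem_iota.
case: s => [//|x t]; rewrite [size _]/= [path _ _ _]/= => /andP[hs /andP[hx ht]].
by exists x, t; rewrite mem_iota IH ht andbT; split.
Qed.

Lemma uniq_box_list a b : uniq (box_list a b).
Proof.
elim: a b => [//|a IH] b; rewrite box_listS; apply: allpairs_dep_inj_uniq.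
- exact: iota_uniq.
- by move=> x _; exact: IH.
- by move=> x x' y y' [-> ->].
Qed.

(* p = (N, m) encodes N + 1 parts, the least of which is m + 1. *)
Definition box_parts (p : nat * nat) (t : seq nat) : seq nat :=
  rcons [seq (x + p.2.+1)%N | x <- t] p.2.+1.

(** With N + 1 parts, K < d means that the largest part exceeds the least by at most N + d, the
    width of the box. *)
Definition kpartitions (T d : nat) : seq (seq nat) :=
  [seq box_parts p t | p <- [seq (N, m) | N <- iota 0 T, m <- iota 0 T],
                       t <- box_list p.1 (p.1 + d)].

Lemma geq_trans : transitive geq.
Proof. by move=> x y z /= h1 h2; exact: leq_trans h2 h1. Qed.

Lemma uniq_kpartitions T d : uniq (kpartitions T d).
Proof.
have inj p p' t t' : box_parts p t = box_parts p' t' -> p.2 = p'.2 /\ t = t'.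
  move=> /rcons_inj[h1 h2]; split=> //; move: h1; rewrite h2.
  by apply: inj_map => x y /addIn.
apply: allpairs_uniq_dep.
- apply: allpairs_dep_inj_uniq; first exact: iota_uniq.
    by move=> *; exact: iota_uniq.
  by move=> x x' y y' [-> ->].
- by move=> p _; exact: uniq_box_list.
move=> u v /allpairsPdep[[N m] [t [_ ht ->]]].
move=> /allpairsPdep[[N' m'] [t' [_ ht' ->]]].
move=> /= /inj[/= em et]; move: ht ht'; rewrite em et !mem_box_list /=.
by move=> /andP[/eqP <- _] /andP[/eqP <- _].
Qed.

Lemma sumn_size s : 0%N \notin s -> (size s <= sumn s)%N.
Proof.
elim: s => //= x s IH; rewrite inE negb_or eq_sym -lt0n => /andP[h /IH]; lia.
Qed.

(** The inverse of [box_parts] removes the last part z and subtracts z from the others. The bound on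
    the sum keeps both the number of parts and z within range. *)
Lemma mem_kpartitions T d s : (sumn s <= T)%N ->
  (s \in kpartitions T d) = [&& sorted geq s, 0%N \notin s, s != [::] &
    (head 0%N s < d + last 0%N s + size s)%N].
Proof.
move=> hT; apply/allpairsPdep/idP => [[[N m] [t [_ ht ->]]]|].
  move: ht; rewrite mem_box_list (path_sortedE geq_trans) /box_parts /=.
  move=> /and3P[/eqP sz ta ts]; apply/and4P; split.
  - rewrite (sorted_pairwise geq_trans) pairwise_rcons pairwise_map all_map.
    apply/andP; split; first by apply/allP => x _ /=; rewrite leq_addl.
    move: ts; rewrite (sorted_pairwise geq_trans).
    by apply: sub_pairwise => x y /=; rewrite leq_add2r.
  - by rewrite mem_rcons inE /=; apply/negP => /mapP[x _]; lia.
  - by case: (t).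
  - rewrite last_rcons size_rcons size_map sz.
    by case: t ta {ts sz} => [|x t] /=; lia.
case/lastP: s hT => [//|u z] hT /and4P[].
rewrite (sorted_pairwise geq_trans) pairwise_rcons mem_rcons inE negb_or.
rewrite [0%N == z]eq_sym -lt0n.
move=> /andP[uz us] /andP[z0 u0] _; rewrite last_rcons size_rcons => hd.
move: hT; rewrite sumn_rcons => hT.
have szu := sumn_size _ u0.
exists (size u, z.-1), [seq (x - z)%N | x <- u]; split.
- apply/allpairsPdep; exists (size u), z.-1.
  rewrite !mem_iota; split=> //=; last by lia.
  by apply: leq_ltn_trans szu _; lia.
- rewrite mem_box_list size_map eqxx (path_sortedE geq_trans) /=.
  apply/andP; split.
    rewrite all_map; apply/allP => x xu /=.
    suff : (x <= head 0 (rcons u z))%N by lia.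
    case: u us xu {uz u0 hT szu hd} => //= y u /andP[yu _].
    by rewrite inE => /orP[/eqP -> //|/(allP yu)].
  rewrite (sorted_pairwise geq_trans) pairwise_map.
  by apply: sub_pairwise us => x y /=; lia.
- rewrite /box_parts /= prednK; last by lia.
  congr rcons; rewrite -map_comp -[LHS]map_id; apply/eq_in_map => x xu /=.
  by have := allP uz _ xu; rewrite /=; lia.
Qed.

Lemma count_kimberlingE (C : int -> bool) (n : nat) (l : seq (seq nat)) :
  (0 < n)%N -> uniq l ->
  (forall s, (s \in l) = is_partition n s && C (kimberling s)) ->
  count_kimberling C n = (size l)%:Z.
Proof.
move=> n0 ul lP; rewrite /count_kimberling ltz_nat n0.
have -> : [set s | is_partition n s && C (kimberling s)] =
          [set` [fset s in l]%fset].
  by apply/seteqP; split=> s /=; rewrite inE /= lP.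
by rewrite set_fsetK card_fseq undup_id.
Qed.

Lemma mem_kpartitions_sum T d (n : nat) s : (0 < n)%N -> (n <= T)%N ->
  (s \in [seq s <- kpartitions T d | sumn s == n]) =
  is_partition n s && (kimberling s < d%:Z).
Proof.
move=> n0 nT; rewrite mem_filter /is_partition eqz_nat.
have [e|] := eqVneq (sumn s) n; last by rewrite !andbF.
rewrite mem_kpartitions ?e // andbT; case: s e => [/= e|x s _]; first by lia.
rewrite -andbA; congr (_ && (_ && _)); rewrite /kimberling /=; lia.
Qed.

Lemma count_kimberling_lt T d (n : nat) (C : int -> bool) :
  (0 < n)%N -> (n <= T)%N -> (forall k, C k = (k < d%:Z)) ->
  count_kimberling C n = (count (fun s => sumn s == n) (kpartitions T d))%:Z.
Proof.
move=> n0 nT CE; rewrite -size_filter; apply: count_kimberlingE => //.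
  by rewrite filter_uniq ?uniq_kpartitions.
by move=> s; rewrite mem_kpartitions_sum // CE.
Qed.

(** K is at most the largest part, hence at most T, so d = T + 1 lists all partitions of n, and K >
    0 is the complement of K <= 0. *)
Lemma K_gtE T (n : nat) : (0 < n)%N -> (n <= T)%N ->
  K_gt n = (count (fun s => sumn s == n) (kpartitions T T.+1))%:Z - K_le n.
Proof.
move=> n0 nT; pose l := [seq s <- kpartitions T T.+1 | sumn s == n].
have ul : uniq l by rewrite filter_uniq ?uniq_kpartitions.
have lP s : (s \in l) = is_partition n s.
  rewrite mem_kpartitions_sum //; have [|//] := boolP (is_partition _ _).
  case/and3P => sS s0 /eqP[es]; rewrite /kimberling /=.
  suff : (head 0 s <= sumn s)%N by lia.
  by case: (s) => //= x t; exact: leq_addr.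
have -> : K_le n = (count (fun s => kimberling s <= 0) l)%:Z.
  rewrite -size_filter; apply: count_kimberlingE => //; first exact: filter_uniq.
  by move=> s; rewrite mem_filter lP andbC.
have -> : K_gt n = (count (predC (fun s => kimberling s <= 0)) l)%:Z.
  rewrite -size_filter; apply: count_kimberlingE => //; first exact: filter_uniq.
  by move=> s; rewrite mem_filter lP andbC /= ltNge.
rewrite -[count _ (kpartitions _ _)]size_filter -/l.
by rewrite -(count_predC (fun s => kimberling s <= 0) l) PoszD addrC addKr.
Qed.

(** * Generating functions of the counts *)

Section GeneratingFunctions.

Context {A : comNzRingType} (q : A) (T : nat).
Hypothesis qT : q ^+ T = 0.

Lemma sum_fibers (X : Type) (w : X -> nat) (c : X -> A) (l : seq X) :
  \sum_(n < T) (\sum_(x <- l | w x == n) c x) * q ^+ n =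
  \sum_(x <- l) c x * q ^+ w x.
Proof.
transitivity (\sum_(n < T) \sum_(x <- l) (if w x == n then c x * q ^+ n else 0)).
  by apply: eq_bigr => n _; rewrite mulr_suml -big_mkcond.
rewrite exchange_big; apply: eq_bigr => x _ /=; rewrite -big_mkcond /=.
have [h|h] := ltnP (w x) T.
  rewrite (eq_bigl (fun n => n == Ordinal h)) ?big_pred1_eq //.
  by move=> n; rewrite -val_eqE eq_sym.
rewrite (expq0 _ _ qT _ h) mulr0 big_pred0 // => n.
by apply/eqP => e; have := ltn_ord n; rewrite -e ltnNge h.
Qed.

(** Sorting by the first entry x gives the sum of q^x [a + x; a] over x <= b, which the Pascal rule
    sums by induction on b. *)
Lemma box_list_gf a b : \sum_(s <- box_list a b) q ^+ sumn s = gauss q T a b.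
Proof.
elim: a b => [|a IH] b; first by rewrite big_seq1 gauss0n // expr0.
rewrite box_listS big_allpairs_dep.
transitivity (\sum_(0 <= x < b.+1) q ^+ x * gauss q T a x).
  rewrite /index_iota subn0; apply: eq_bigr => x _; rewrite -IH mulr_sumr.
  by apply: eq_bigr => s _; rewrite /= exprD.
elim: b => [|b IHb]; first by rewrite big_nat1 !gaussn0 // mulr1.
by rewrite big_nat_recr //= IHb gaussS' // addrC.
Qed.

(** The least part contributes N + 1 times, and summing over it gives q^(N+1) / (1 - q^(N+1)); the
    rest is the Gaussian binomial of the N by N + d box. *)
Lemma kpartitions_gf d :
  \sum_(s <- kpartitions T d) q ^+ sumn s = kgf q T d.
Proof.
rewrite /kpartitions big_allpairs_dep big_allpairs_dep /kgf.
rewrite -[iota 0 T](congr1 (iota 0) (subn0 T)) -/(index_iota 0 T) big_mkord.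
apply: eq_bigr => N _.
transitivity (\sum_(0 <= m < T) q ^+ (N.+1 * m.+1) * gauss q T N (N + d)).
  apply: eq_bigr => m _; rewrite -box_list_gf mulr_sumr !big_seq.
  apply: eq_bigr => t; rewrite mem_box_list => /andP[/eqP sz _].
  rewrite -exprD /box_parts /= sumn_rcons; congr (q ^+ _).
  have -> : sumn [seq (x + m.+1)%N | x <- t] = (sumn t + size t * m.+1)%N.
    by elim: (t) => //= x u ->; lia.
  by rewrite sz /=; lia.
rewrite -mulr_suml big_mkord gauss_poch // addSn iqfacS.
have -> : \sum_(m < T) q ^+ (N.+1 * m.+1) = q ^+ N.+1 * geo T (q ^+ N.+1).
  by rewrite mulr_sumr; apply: eq_bigr => m _; rewrite mulnS exprD exprM.
by ring.
Qed.

Lemma count_kimberling_gf d (C : int -> bool) : (forall k, C k = (k < d%:Z)) ->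
  \sum_(n < T) (count_kimberling C n)%:~R * q ^+ n = kgf q T d.
Proof.
move=> CE; rewrite -kpartitions_gf.
transitivity (\sum_(n < T) (\sum_(s <- kpartitions T d | sumn s == n) 1) * q ^+ n).
  apply: eq_bigr => n _; rewrite big_const_seq iter_addr_0.
  have [n0|n0] := posnP n; last by rewrite (count_kimberling_lt T d) // ltnW.
  (* At n = 0 the count is 0 by convention, and each listed partition has a positive last part. *)
  rewrite n0 (_ : count _ _ = 0%N) //; apply/eqP; rewrite -leqn0 leqNgt -has_count.
  apply/hasPn => s /allpairsPdep[p [t [_ _ ->]]].
  by rewrite /box_parts sumn_rcons addnS.
by rewrite sum_fibers; under eq_bigr do rewrite mul1r.
Qed.

Lemma K_gt_gf :
  \sum_(n < T) (K_gt n)%:~R * q ^+ n = kgf q T T.+1 - kgf q T 1.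
Proof.
rewrite -(@count_kimberling_gf 1 (fun k => k <= 0)) => [|k]; last first.
  by rewrite -ltzD1 add0r.
rewrite -(@count_kimberling_gf T.+1 (fun k => k < T.+1%:Z)) //.
rewrite -sumrB; apply: eq_bigr => n _; rewrite -mulrBl -rmorphB.
have [n0|n0] := posnP n; first by rewrite n0 /K_gt /count_kimberling ltxx subrr.
have nT : (n <= T)%N by exact: ltnW.
by rewrite (K_gtE T) // (count_kimberling_lt T T.+1).
Qed.

End GeneratingFunctions.

(** * The congruences *)

Lemma Zp4_int_eq0 (a : int) : (a%:~R == 0 :> 'Z_4) = (4 %| a)%Z.
Proof.
have natE (n : nat) : (n%:R == 0 :> 'Z_4) = (4 %| n)%N.
  by rewrite -val_eqE /= val_Zp_nat.
by case: (intP a) => [|n|n]; rewrite ?mulrNz ?oppr_eq0 ?dvdzE ?abszN -?pmulrn natE.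
Qed.

Definition gf {A : comNzRingType} (q : A) (T : nat) (c : nat -> int) : A :=
  \sum_(n < T) (c n)%:~R * q ^+ n.

(** The hypothesis is used in (Z/4)[X] / (X^(n+1)) with q the class of X; comparing coefficients of
    X^n gives the congruence. *)
Lemma eq_mod4_gf (a b : nat -> int) :
  (forall (A : comNzRingType) (q : A) (T : nat), q ^+ T = 0 -> 4%:R = 0 :> A ->
    gf q T a = gf q T b) ->
  forall n, (a n = b n %[mod 4])%Z.
Proof.
move=> gfE n; pose t := n; have nt : (n < t.+1)%N by [].
pose h : {poly 'Z_4} := 'X^(t.+1).
pose q : {poly %/ h} := in_qpoly h 'X.
have hM : mk_monic h = h by rewrite /h mk_monic_Xn.
have qT : q ^+ t.+1 = 0.
  rewrite /q -rmorphXn -/h; apply: val_inj => /=.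
  by rewrite hM Pdiv.RingMonic.rmodpp // monicXn.
have q4 : 4%:R = 0 :> {poly %/ h}.
  rewrite -(rmorph_nat (in_qpoly h)) -polyC_natr (_ : 4%:R = 0) ?rmorph0 //.
  by apply/eqP.
have in_gf (c : nat -> int) : \sum_(n < t.+1) (c n)%:~R * q ^+ n =
    in_qpoly h (\poly_(n < t.+1) (c n)%:~R).
  rewrite poly_def rmorph_sum; apply: eq_bigr => i _.
  by rewrite -mul_polyC rmorphM rmorphXn /= -[_%:P]/((c i)%:~R%:P) !rmorph_int.
have := gfE _ q _ qT q4; rewrite /gf !in_gf.
move=> /(congr1 (fun p : {poly %/ h} => (p : {poly 'Z_4})`_n)).
rewrite !in_qpoly_small ?hM ?size_polyXn ?ltnS ?size_poly //.
rewrite !coef_poly nt => /eqP; rewrite -subr_eq0 -rmorphB /= Zp4_int_eq0.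
by rewrite -eqz_mod_dvd => /eqP.
Qed.

(** * Pentagonal and triangular numbers at integers *)

Arguments pent m : simpl never.
Arguments tri k : simpl never.

Lemma int_parity (m : int) : exists k, m = 2 * k \/ m = 2 * k + 1.
Proof.
exists (m %/ 2)%Z; have := divz_eq m 2; have := @modz_ge0 m 2 isT.
by have := @ltz_pmod m 2 isT; lia.
Qed.

Lemma pentE (m : int) : 2 * pent m = m * (3 * m - 1).
Proof.
rewrite /pent; have [k [->|->]] := int_parity m.
  by rewrite -mulrA mulKz.
rewrite (_ : (2 * k + 1) * (3 * (2 * k + 1) - 1) =
             2 * ((2 * k + 1) * (3 * k + 1))).
  by rewrite mulKz.
by ring.
Qed.

Lemma triE (m : int) : 2 * tri m = m * (m + 1).
Proof.
rewrite /tri; have [k [->|->]] := int_parity m; first by rewrite -mulrA mulKz.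
rewrite (_ : (2 * k + 1) * (2 * k + 1 + 1) = 2 * ((2 * k + 1) * (k + 1))).
  by rewrite mulKz.
by ring.
Qed.

(** This bounds every pentagonal index by the number represented, which makes the index sets
    finite. *)
Lemma pent_ge (m : int) : `|m| <= pent m.
Proof. by have := pentE m; nia. Qed.

Lemma pent_ge0 (m : int) : 0 <= pent m.
Proof. exact: le_trans (normr_ge0 _) (pent_ge m). Qed.

Lemma tri_ge (m : int) : 0 <= m -> m <= tri m.
Proof. by have := triE m; nia. Qed.

Lemma bin2E (k : nat) : (2 * 'C(k.+1, 2) = k * k.+1)%N.
Proof. by elim: k => // k IH; rewrite bin2S; lia. Qed.

Lemma tri_nat (k : nat) : tri k%:Z = 'C(k.+1, 2)%:Z.
Proof. by have := triE k; have := bin2E k; lia. Qed.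

Lemma pent_nat (l : nat) : pent l%:Z = (pentn l)%:Z.
Proof. by have := pentE l; have := bin2E l; rewrite bin2S /pentn; nia. Qed.

Lemma pent_opp_nat (l : nat) : pent (- l%:Z) = (pentn l + l)%:Z.
Proof. by have := pentE (- l%:Z); have := bin2E l; rewrite bin2S /pentn; nia. Qed.

Lemma signzD (a b : int) : (-1 : int) ^ (a + b) = (-1) ^ a * (-1) ^ b.
Proof. by rewrite exprzDr ?unitrN1. Qed.

Lemma signzN (a : int) : (-1 : int) ^ (- a) = (-1) ^ a.
Proof. by rewrite -exprz_inv invrN1. Qed.

(** * Finite index ranges and summation bounds *)

Lemma uniq_allpair (X Y : eqType) (a : seq X) (b : seq Y) :
  uniq a -> uniq b -> uniq [seq (x, y) | x <- a, y <- b].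
Proof. by move=> ua ub; apply: allpairs_uniq => // -[? ?] [? ?]. Qed.

Lemma mem_allpair (X Y : eqType) (a : seq X) (b : seq Y) x y :
  ((x, y) \in [seq (x, y) | x <- a, y <- b]) = (x \in a) && (y \in b).
Proof.
apply/allpairsP/andP => [[[x' y'] [/= ? ? [-> ->]]] //|[? ?]].
by exists (x, y).
Qed.

Definition pos_range (T : nat) : seq int := [seq i.+1%:Z | i <- iota 0 T].
Definition nat_range (T : nat) : seq int := [seq i%:Z | i <- iota 0 T].
(** The order 0, positive, negative lets [phiE] pair r with -r. *)
Definition int_range (T : nat) : seq int :=
  0 :: pos_range T ++ [seq - x | x <- pos_range T].

Lemma mem_pos_range T (x : int) : (x \in pos_range T) = (1 <= x <= T%:Z).
Proof.
apply/mapP/idP => [[i]|h]; first by rewrite mem_iota => ? ->; lia.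
by exists (`|x|.-1)%N; rewrite ?mem_iota; lia.
Qed.

Lemma mem_nat_range T (x : int) : (x \in nat_range T) = (0 <= x < T%:Z).
Proof.
apply/mapP/idP => [[i]|h]; first by rewrite mem_iota => ? ->; lia.
by exists (`|x|)%N; rewrite ?mem_iota; lia.
Qed.

Lemma mem_int_range T (x : int) : (x \in int_range T) = (`|x| <= T%:Z).
Proof.
rewrite inE mem_cat mem_pos_range.
have -> : (x \in [seq - x | x <- pos_range T]) = (- x \in pos_range T).
  by rewrite -{1}[x]opprK mem_map //; exact: oppr_inj.
by rewrite mem_pos_range; lia.
Qed.

Lemma uniq_pos_range T : uniq (pos_range T).
Proof. by rewrite map_inj_uniq ?iota_uniq // => x y []. Qed.

Lemma uniq_nat_range T : uniq (nat_range T).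
Proof. by rewrite map_inj_uniq ?iota_uniq // => x y []. Qed.

Lemma uniq_int_range T : uniq (int_range T).
Proof.
have uN : uniq [seq - x | x <- pos_range T].
  by rewrite map_inj_uniq ?uniq_pos_range //; exact: oppr_inj.
rewrite /= cat_uniq uniq_pos_range uN.
rewrite mem_cat mem_pos_range /= andbT; apply/andP; split.
  by apply/mapP => -[x]; rewrite mem_pos_range; lia.
by apply/hasPn => x /mapP[y]; rewrite /= !mem_pos_range; lia.
Qed.

Arguments int_range T : simpl never.

Lemma fsbig_seq_filter (X : choiceType) (D : X -> Prop) (Db : pred X)
    (l : seq X) (f : X -> int) :
  uniq l -> (forall x, D x <-> (x \in l) && Db x) ->
  \sum_(x \in [set x | D x]) f x = \sum_(x <- l | Db x) f x.
Proof.
move=> ul DP; rewrite -[RHS]big_filter [RHS]fsbig_seq ?filter_uniq //.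
apply: eq_fsbigl; apply/seteqP; split=> x /=; rewrite mem_filter.
  by move=> /DP; rewrite andbC.
by rewrite andbC => /DP.
Qed.

(** The bounds say |6m - 1| < sqrt(1 + 12n), and (6m - 1)^2 = 1 + 24 P_m. *)
Lemma m_rangeE (R : realType) (n : nat) (m : int) :
  (m_min R n <= m <= m_max R n) = (2 * pent m < n%:Z).
Proof.
pose x : R := 1 + 12 * n%:~R; pose s := Num.sqrt x.
have x0 : 0 < x by rewrite ltr_pwDl // mulr_ge0 // ler0z.
have s0 : 0 <= s by exact: sqrtr_ge0.
have s2 : s ^+ 2 = x by rewrite sqr_sqrtr // ltW.
rewrite /m_min /m_max lezD1 floor_lt_int lerBrDr lezD1 ceil_gt_int -/x -/s.
transitivity (`|6 * m%:~R - 1| < s).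
  rewrite ltr_norml ltr_pdivrMr // ltr_pdivlMr //.
  by congr (_ && _); apply/idP/idP => h; lra.
rewrite -(ltr_pXn2r (_ : 0 < 2)%N) ?nnegrE // s2 real_normK ?num_real //.
transitivity (((6 * m - 1) ^+ 2)%:~R < (1 + 12 * n%:Z)%:~R :> R).
  by rewrite !(rmorphXn, rmorphB, rmorphD, rmorphM, rmorph_nat, rmorph1).
by rewrite ltr_int; have := pentE m; lia.
Qed.

(** The upper bound says 2k + 1 < sqrt(1 + 8n), and (2k + 1)^2 = 1 + 8 T_k. *)
Lemma k_rangeE (R : realType) (n : nat) (k : int) :
  (0 <= k <= k_max R n) = (0 <= k) && (tri k < n%:Z).
Proof.
case: (lerP 0 k) => //= k0.
pose x : R := 1 + 8 * n%:~R; pose s := Num.sqrt x.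
have x0 : 0 < x by rewrite ltr_pwDl // mulr_ge0 // ler0z.
have s0 : 0 <= s by exact: sqrtr_ge0.
have s2 : s ^+ 2 = x by rewrite sqr_sqrtr // ltW.
rewrite /k_max lerBrDr lezD1 ceil_gt_int -/x -/s.
have k0' : (0 : R) <= k%:~R by rewrite ler0z.
transitivity (2 * k%:~R + 1 < s).
  by rewrite ltr_pdivlMr //; apply/idP/idP => h; lra.
rewrite -(ltr_pXn2r (_ : 0 < 2)%N) ?nnegrE ?s2 //; last by lra.
transitivity (((2 * k + 1) ^+ 2)%:~R < (1 + 8 * n%:Z)%:~R :> R).
  by rewrite !(rmorphXn, rmorphB, rmorphD, rmorphM, rmorph_nat, rmorph1).
by rewrite ltr_int; have := triE k; lia.
Qed.

(** The added indices give K an argument <= 0. The new ranges depend on T alone, so they can be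
    exchanged with a sum over n. *)
Lemma double_sumE (R : realType) (K : int -> int) (T n : nat) :
  (forall j, j <= 0 -> K j = 0) -> (n <= T)%N ->
  double_sum R K n = \sum_(m <- int_range T) \sum_(k <- nat_range T)
    (-1) ^ m * K (n%:Z - tri k - 2 * pent m).
Proof.
move=> K0 nT; rewrite /double_sum.
rewrite (@fsbig_seq_filter _ _ (fun m => 2 * pent m < n%:Z) (int_range T));
  [|exact: uniq_int_range|]; last first.
  move=> m; rewrite m_rangeE mem_int_range; split=> [h|/andP[_ //]].
  by rewrite h andbT; have := pent_ge m; lia.
rewrite big_mkcond; apply: eq_bigr => m _.
have tri0 k : k \in nat_range T -> 0 <= tri k.
  by rewrite mem_nat_range => /andP[h _]; exact: le_trans h (tri_ge _ h).
case: ifP => hm; last first.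
  rewrite big_seq big1 // => k /tri0 hk; rewrite K0 ?mulr0 //; lia.
rewrite (@fsbig_seq_filter _ _ (fun k => tri k < n%:Z) (nat_range T));
  [|exact: uniq_nat_range|]; last first.
  move=> k; rewrite k_rangeE mem_nat_range.
  split=> [/andP[k0 h]|/andP[/andP[k0 _] h]].
    by rewrite h k0 /=; have := tri_ge _ k0; lia.
  by rewrite k0.
rewrite big_mkcond; apply: eq_bigr => k _; case: ifP => // hk.
by rewrite K0 ?mulr0 //; have := pent_ge0 m; lia.
Qed.

(** * Generating functions of both sides *)

Section Congruence.

Context {A : comNzRingType} (q : A) (T : nat).
Hypothesis qT : q ^+ T = 0.

Local Notation gf := (gf q T).

Lemma gf_shift (c : int -> int) (w : nat) : (forall j, j <= 0 -> c j = 0) ->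
  gf (fun n => c (n%:Z - w%:Z)) = q ^+ w * gf (fun n => c n%:Z).
Proof.
move=> c0; rewrite /gf mulr_sumr.
pose F (j : nat) := if (w <= j)%N then (c (j%:Z - w%:Z))%:~R * q ^+ j else 0.
transitivity (\sum_(0 <= j < T) F j).
  rewrite big_mkord; apply: eq_bigr => j _; rewrite /F; case: leqP => // h.
  by rewrite c0 ?mul0r //; lia.
(* The terms from T on vanish with q^j; they are added so that removing the first w leaves exactly T
   terms. *)
transitivity (\sum_(0 <= j < T + w) F j).
  rewrite [RHS](big_cat_nat (n := T)) ?leq_addr //=.
  rewrite [X in _ + X]big1_seq ?addr0 //.
  move=> j /andP[_]; rewrite mem_index_iota => /andP[h _].
  by rewrite /F (expq0 _ _ qT) // mulr0; case: ifP.
rewrite (big_cat_nat (n := w)) ?leq_addl //=.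
rewrite [X in X + _]big1_seq ?add0r; last first.
  by move=> j /andP[_]; rewrite mem_index_iota /F => /andP[_ h]; rewrite leqNgt h.
rewrite -{1}[w]add0n big_addn addnK big_mkord; apply: eq_bigr => j _.
rewrite /F leq_addl exprD PoszD addrK; ring.
Qed.

(** The pentagonal series for (q^2; q^2)_oo, a common factor of the two sides of each congruence. *)
Definition sign_pent2 : A :=
  \sum_(m <- int_range T) ((-1) ^ m)%:~R * q ^+ (2 * `|pent m|).

Lemma psiE : psi q T = \sum_(k <- nat_range T) q ^+ `|tri k|.
Proof.
rewrite big_map -[iota 0 T](congr1 (iota 0) (subn0 T)) -/(index_iota 0 T) big_mkord.
by apply: eq_bigr => k _; rewrite tri_nat.
Qed.

Lemma gf_double_sum (R : realType) (K : int -> int) :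
  (forall j, j <= 0 -> K j = 0) ->
  gf (fun n => double_sum R K n) =
  sign_pent2 * psi q T * gf (fun n => K n%:Z).
Proof.
move=> K0; rewrite {1}/gf.
transitivity (\sum_(n < T) \sum_(m <- int_range T) \sum_(k <- nat_range T)
    ((-1) ^ m)%:~R * ((K (n%:Z - (`|tri k| + 2 * `|pent m|)%N%:Z))%:~R * q ^+ n)).
  apply: eq_bigr => n _; rewrite (double_sumE R K T) //; last exact: ltnW.
  rewrite rmorph_sum mulr_suml; apply: eq_bigr => m _.
  rewrite rmorph_sum mulr_suml !big_seq; apply: eq_bigr => k.
  rewrite mem_nat_range => /andP[k0 _].
  rewrite rmorphM -mulrA PoszD PoszM !gez0_abs ?pent_ge0 ?opprD ?addrA //.
  exact: le_trans k0 (tri_ge _ k0).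
rewrite exchange_big /sign_pent2 -mulrA mulr_suml; apply: eq_bigr => m _.
rewrite exchange_big psiE mulr_suml mulr_sumr; apply: eq_bigr => k _.
rewrite -mulr_sumr -/(gf (fun n => K (n%:Z - (`|tri k| + 2 * `|pent m|)%N%:Z))).
by rewrite gf_shift // exprD; ring.
Qed.

Lemma phiE : \sum_(r <- int_range T) ((-1) ^ r)%:~R * q ^+ `|pent r| = phi q T.
Proof.
rewrite big_cons big_cat big_map [X in _ + (_ + X)]big_map big_map.
rewrite (_ : pent 0 = 0) // expr0z !mul1r -[phi q T](subKr 1) pentagonal // -sumrN.
rewrite -[iota 0 T](congr1 (iota 0) (subn0 T)) -/(index_iota 0 T) !big_mkord.
rewrite -big_split; congr (_ + _); apply: eq_bigr => l _.
rewrite signzN pent_nat pent_opp_nat !absz_nat exprD -exprnP rmorphXn rmorphN1.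
by rewrite /= [(-1) ^+ l.+1]exprS; ring.
Qed.

Lemma sum_allpairs (X Y : Type) (l : seq X) (m : seq Y) (F : X -> A) (G : Y -> A) :
  \sum_(p <- [seq (x, y) | x <- l, y <- m]) F p.1 * G p.2 =
  (\sum_(x <- l) F x) * (\sum_(y <- m) G y).
Proof. by rewrite big_allpairs_dep big_distrlr. Qed.

Lemma gf_fsbig (X : choiceType) (D : nat -> X -> Prop) (f : X -> int)
    (w : X -> nat) (l : seq X) : uniq l ->
  (forall n x, (n < T)%N -> D n x <-> (x \in l) && (w x == n)) ->
  gf (fun n => \sum_(x \in [set x | D n x]) f x) =
  \sum_(x <- l) (f x)%:~R * q ^+ w x.
Proof.
move=> ul DP; rewrite -(sum_fibers _ _ qT); apply: eq_bigr => n _.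
rewrite (fsbig_seq_filter _ _ (fun x => w x == n) _ _ ul) ?rmorph_sum //.
by move=> x; exact: DP.
Qed.

(** The variables separate: r and s give (q)_oo each and t gives [sign_pent2]. Here p l is P_l or
    P_(-l), and l <= p l bounds l. *)
Lemma gf_pent4 (c p : int -> int) (f : int * int * int * int -> int) :
  (forall l, 1 <= l -> l <= p l) ->
  (forall r s t l, f (r, s, t, l) = (-1) ^ (r + s + t) * c l) ->
  gf (fun n => \sum_(x \in [set x : int * int * int * int |
        let: (r, s, t, l) := x in
        1 <= l /\ n%:Z = pent r + pent s + 2 * pent t + p l]) f x) =
  phi q T ^+ 2 * sign_pent2 *
    \sum_(i < T) (c i.+1%:Z)%:~R * q ^+ `|p i.+1%:Z|.
Proof.
move=> pl fE; pose I := int_range T.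
pose w (x : int * int * int * int) : nat := let: (r, s, t, l) := x in
  (`|pent r| + `|pent s| + 2 * `|pent t| + `|p l|)%N.
rewrite (@gf_fsbig _ _ _ w [seq (x, l) | x <- [seq (y, t) | y <-
    [seq (r, s) | r <- I, s <- I], t <- I], l <- pos_range T]).
- pose F (r : int) : A := ((-1) ^ r)%:~R * q ^+ `|pent r|.
  transitivity ((\sum_(r <- I) F r) * (\sum_(s <- I) F s) * sign_pent2 *
      \sum_(l <- pos_range T) (c l)%:~R * q ^+ `|p l|).
    rewrite -sum_allpairs /sign_pent2 -sum_allpairs.
    rewrite -(@sum_allpairs _ _ _ _ (fun x => F x.1.1 * F x.1.2 *
       (((-1) ^ x.2)%:~R * q ^+ (2 * `|pent x.2|)))).
    apply: eq_bigr => -[[[r s] t] l] _ /=.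
    by rewrite fE !signzD !rmorphM !exprD /F; ring.
  rewrite phiE -expr2 big_map.
  by rewrite -[iota 0 T](congr1 (iota 0) (subn0 T)) -/(index_iota 0 T) big_mkord.
- by rewrite !uniq_allpair ?uniq_int_range ?uniq_pos_range.
- move=> n [[[r s] t] l] nT.
  rewrite /w !mem_allpair !mem_int_range mem_pos_range.
  have := pent_ge r; have := pent_ge s; have := pent_ge t.
  split=> [[l1 e]|]; first by have := pl l l1; lia.
  by move=> /andP[/andP[_ /andP[l1 _]]]; have := pl l l1; lia.
Qed.

(** As in [gf_pent4], with j adding the factor q / (1 - q). The list [r5] holds the relevant l >= a,
    so that a = 0 and a = 1 are treated together. *)
Lemma gf_pent5 (a : int) (r5 : seq int) (p : int -> int) :
  uniq r5 -> (forall l, l \in r5 -> a <= l) ->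
  (forall l, a <= l -> p l < T%:Z -> l \in r5) -> (forall l, a <= l -> 0 <= p l) ->
  gf (fun n => \sum_(x \in [set x : int * int * int * int * int |
        let: (r, s, t, j, l) := x in
        [/\ 1 <= j, a <= l & n%:Z = pent r + pent s + 2 * pent t + j + p l]])
      (let: (r, s, t, j, l) := x in (-1 : int) ^ (r + s + t + l))) =
  phi q T ^+ 2 * sign_pent2 * (\sum_(j < T) q ^+ j.+1) *
    \sum_(l <- r5) ((-1) ^ l)%:~R * q ^+ `|p l|.
Proof.
move=> ur5 r5a ar5 p0; pose I := int_range T.
pose w (x : int * int * int * int * int) : nat := let: (r, s, t, j, l) := x in
  (`|pent r| + `|pent s| + 2 * `|pent t| + `|j| + `|p l|)%N.
rewrite (@gf_fsbig _ _ _ w [seq (x, l) | x <- [seq (z, j) | z <-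
    [seq (y, t) | y <- [seq (r, s) | r <- I, s <- I], t <- I],
    j <- pos_range T], l <- r5]).
- pose F (r : int) : A := ((-1) ^ r)%:~R * q ^+ `|pent r|.
  transitivity ((\sum_(r <- I) F r) * (\sum_(s <- I) F s) * sign_pent2 *
      (\sum_(j <- pos_range T) q ^+ `|j|) *
      \sum_(l <- r5) ((-1) ^ l)%:~R * q ^+ `|p l|).
    rewrite -sum_allpairs /sign_pent2 -sum_allpairs.
    rewrite -(@sum_allpairs _ _ _ _ (fun x => F x.1.1 * F x.1.2 *
       (((-1) ^ x.2)%:~R * q ^+ (2 * `|pent x.2|)))).
    rewrite -(@sum_allpairs _ _ _ _ (fun x => F x.1.1.1 * F x.1.1.2 *
       (((-1) ^ x.1.2)%:~R * q ^+ (2 * `|pent x.1.2|)) * q ^+ `|x.2|)).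
    apply: eq_bigr => -[[[[r s] t] j] l] _ /=.
    by rewrite !signzD !rmorphM !exprD /F; ring.
  rewrite phiE -expr2 [\sum_(j <- pos_range T) _]big_map.
  by rewrite -[iota 0 T](congr1 (iota 0) (subn0 T)) -/(index_iota 0 T) big_mkord.
- by rewrite !uniq_allpair ?uniq_int_range ?uniq_pos_range.
- move=> n [[[[r s] t] j] l] nT.
  rewrite /w !mem_allpair !mem_int_range mem_pos_range.
  have := pent_ge r; have := pent_ge s; have := pent_ge t.
  move=> h1 h2 h3; split=> [[j1 al e]|].
    have pl0 := p0 l al; rewrite (ar5 l al); last by lia.
    by lia.
  move=> /andP[/andP[/andP[_ /andP[j1 _]] /r5a al] /eqP e].
  by have := p0 l al; split=> //; lia.
Qed.

End Congruence.

Lemma count_kimberling_le0 (C : int -> bool) (j : int) :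
  j <= 0 -> count_kimberling C j = 0.
Proof. by rewrite /count_kimberling leNgt => /negbTE ->. Qed.

Theorem theorem3p5 (R : realType) (n : int) (hn : 0 < n) :
  [/\ (double_sum R K_le n =
         \sum_(x \in [set x : int * int * int * int | let: (r, s, t, l) := x in
             1 <= l /\ n = pent r + pent s + 2 * pent t + pent l])
           (let: (r, s, t, l) := x in (-1 : int) ^ (r + s + t + l - 1) * l)
       + \sum_(x \in [set x : int * int * int * int | let: (r, s, t, l) := x in
             1 <= l /\ n = pent r + pent s + 2 * pent t + pent (- l)])
           (let: (r, s, t, l) := x in (-1 : int) ^ (r + s + t + l - 1) * l)
       %[mod 4])%Z,
      (double_sum R K_lt n =
         \sum_(x \in [set x : int * int * int * int * int |
             let: (r, s, t, j, l) := x in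
             [/\ 1 <= j, 0 <= l &
               n = pent r + pent s + 2 * pent t + j + pent (- l)]])
           (let: (r, s, t, j, l) := x in (-1 : int) ^ (r + s + t + l))
       + \sum_(x \in [set x : int * int * int * int * int |
             let: (r, s, t, j, l) := x in
             [/\ 1 <= j, 1 <= l &
               n = pent r + pent s + 2 * pent t + j + 3 * tri l]])
           (let: (r, s, t, j, l) := x in (-1 : int) ^ (r + s + t + l))
       %[mod 4])%Z &
      (double_sum R K_gt n =
         \sum_(x \in [set x : int * int * int * int | let: (r, s, t, l) := x in
             1 <= l /\ n = pent r + pent s + 2 * pent t + pent l])
           (let: (r, s, t, l) := x in (-1 : int) ^ (r + s + t + l) * (l - 1))
       + \sum_(x \in [set x : int * int * int * int | let: (r, s, t, l) := x in
             1 <= l /\ n = pent r + pent s + 2 * pent t + pent (- l)])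
           (let: (r, s, t, l) := x in (-1 : int) ^ (r + s + t + l) * (l - 1))
       %[mod 4])%Z].
Proof.
case: n hn => // n _.
have gfD (A : comNzRingType) (q : A) T (a b : nat -> int) :
    gf q T (fun n => a n + b n) = gf q T a + gf q T b.
  by rewrite /gf -big_split; apply: eq_bigr => i _; rewrite /= rmorphD mulrDl.
have pent_pos l : 1 <= l -> l <= pent l by move=> ?; have := pent_ge l; lia.
have pent_neg l : 1 <= l -> l <= pent (- l)
  by move=> ?; have := pent_ge (- l); lia.
(* Replacing psi by (q)_oo^3 leaves (q)_oo^2 [sign_pent2] times (q)_oo G on the left; the right side
   has the same first two factors. *)
split; move: n; apply: eq_mod4_gf => A q T qT A4; rewrite gfD gf_double_sum //;
  try exact: count_kimberling_le0; rewrite psi_mod4 //.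
- have -> : gf q T (fun n => K_le n%:Z) = kgf q T 1.
    by apply: count_kimberling_gf => // k; rewrite -ltzD1 add0r.
  have fE r s t l : (-1 : int) ^ (r + s + t + l - 1) * l =
      (-1) ^ (r + s + t) * ((-1) ^ (l - 1) * l).
    by rewrite -addrA signzD mulrA.
  rewrite (@gf_pent4 _ _ _ qT (fun l => (-1) ^ (l - 1) * l) pent) //.
  rewrite (@gf_pent4 _ _ _ qT (fun l => (-1) ^ (l - 1) * l)
    (fun l => pent (- l))) //.
  rewrite -mulrDr -big_split.
  transitivity (phi q T ^+ 2 * sign_pent2 q T * (phi q T * kgf q T 1)).
    by ring.
  congr (_ * _); rewrite phi_kgf1 //; apply: eq_bigr => l _.
  rewrite pent_nat pent_opp_nat !absz_nat /= -addn1 PoszD addrK addn1.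
  by rewrite -exprnP rmorphM rmorphXn rmorphN1; ring.
- have -> : gf q T (fun n => K_lt n%:Z) = kgf q T 0.
    exact: count_kimberling_gf.
  (* As l = 0 is allowed here, l runs over 0, ..., T, which are the T + 1 terms in [phi_kgf0]. *)
  rewrite (@gf_pent5 _ _ _ qT 0 (nat_range T.+1) (fun l => pent (- l))).
  + rewrite (@gf_pent5 _ _ _ qT 1 (pos_range T) (fun l => 3 * tri l)).
    * rewrite -mulrDr.
      transitivity (phi q T ^+ 2 * sign_pent2 q T * (phi q T * kgf q T 0)).
        by ring.
      rewrite phi_kgf0 // -[RHS]mulrA; congr (_ * (_ * _)).
      rewrite !big_map -[iota 0 T](congr1 (iota 0) (subn0 T)) -/(index_iota 0 T).
      rewrite -[iota 0 T.+1](congr1 (iota 0) (subn0 T.+1)) -/(index_iota 0 T.+1).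
      rewrite !big_mkord; congr (_ + _); apply: eq_bigr => l _.
        by rewrite pent_opp_nat absz_nat -exprnP rmorphXn rmorphN1.
      by rewrite tri_nat abszM !absz_nat -exprnP rmorphXn rmorphN1.
    * exact: uniq_pos_range.
    * by move=> l; rewrite mem_pos_range => /andP[].
    * by move=> l l1; rewrite mem_pos_range; have := @tri_ge l; lia.
    * by move=> l l1; have := @tri_ge l; lia.
  + exact: uniq_nat_range.
  + by move=> l; rewrite mem_nat_range => /andP[].
  + by move=> l l0; rewrite mem_nat_range; have := pent_ge (- l); lia.
  + by move=> l _; exact: pent_ge0.
- have -> : gf q T (fun n => K_gt n%:Z) = kgf q T T.+1 - kgf q T 1.
    exact: K_gt_gf.
  have fE r s t l : (-1 : int) ^ (r + s + t + l) * (l - 1) =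
      (-1) ^ (r + s + t) * ((-1) ^ l * (l - 1)).
    by rewrite signzD mulrA.
  rewrite (@gf_pent4 _ _ _ qT (fun l => (-1) ^ l * (l - 1)) pent) //.
  rewrite (@gf_pent4 _ _ _ qT (fun l => (-1) ^ l * (l - 1))
    (fun l => pent (- l))) //.
  rewrite -mulrDr -big_split.
  transitivity (phi q T ^+ 2 * sign_pent2 q T *
    (phi q T * kgf q T T.+1 - phi q T * kgf q T 1)); first by ring.
  (* With l = L + 1, the coefficients (-1)^L and (-1)^L (L + 1) differ by (-1)^l (l - 1). *)
  congr (_ * _); rewrite phi_kgf1 // phi_kgf_all // -sumrB.
  apply: eq_bigr => l _.
  rewrite pent_nat pent_opp_nat !absz_nat (_ : l.+1%:Z - 1 = l%:Z) /=; last by lia.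
  rewrite -exprnP rmorphM rmorphXn rmorphN1 /= exprS -pmulrn -natr1; ring.
Qed.
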